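(* Let $\mathscr{H}$ be a complex Hilbert space, $d\ge1$, and let $\mathbf{A}=(A_1,\ldots,A_d)$, $\mathbf{B}=(B_1,\ldots,B_d)$, $\mathbf{C}=(C_1,\ldots,C_d)\in\mathbb{B}^d(\mathscr{H})$, where $\mathbf{A}$ and $\mathbf{B}$ are positive (i.e., $A_k$ and $B_k$ are positive for each $k=1,2,\ldots,d$). If $\begin{bmatrix}\mathbf{A}&\mathbf{C}^*\\ \mathbf{C}&\mathbf{B}\end{bmatrix}$ is positive, then (i) $w_e(\mathbf{C})\le\sqrt{\frac12\left\|\sum_{k=1}^d\left(A_k^2+B_k^2\right)\right\|}$. (ii) $w_e(\mathbf{C})\le\sqrt{\frac12\|\mathbf{A}\|\|\mathbf{B}\|+\frac{\sqrt d}{2}w_e(\mathbf{A}\mathbf{B})}$. (iii) $w_e(\mathbf{C})\le\sqrt{\frac14\left\|\sum_{k=1}^d\left(A_k^2+B_k^2\right)\right\|+\frac{\sqrt d}{2}w_e(\mathbf{A}\mathbf{B})}$.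
   Context: $\mathbb{B}(\mathscr{H})$ is the algebra of bounded linear operators on the complex Hilbert space $\mathscr{H}$, and $\mathbb{B}^d(\mathscr{H})$ is the set of $d$-tuples of such operators. A positive operator $T$ is one with $\langle Tx,x\rangle\ge0$ for all $x$; a $d$-tuple is positive if each component is positive. For $\mathbf{T}=(T_1,\ldots,T_d)$, the Euclidean operator radius is $w_e(\mathbf{T})=\sup\{(\sum_{k=1}^d|\langle T_kx,x\rangle|^2)^{1/2}:\|x\|=1\}$ and the Euclidean operator norm is $\|\mathbf{T}\|=\sup\{(\sum_{k=1}^d\|T_kx\|^2)^{1/2}:\|x\|=1\}$; $\|T\|$ for a single operator is the operator norm. Products and adjoints of tuples are componentwise: $\mathbf{A}\mathbf{B}=(A_1B_1,\ldots,A_dB_d)$, $\mathbf{C}^*=(C_1^*,\ldots,C_d^* )$. The block matrix $\begin{bmatrix}\mathbf{A}&\mathbf{C}^*\\ \mathbf{C}&\mathbf{B}\end{bmatrix}$ is the $d$-tuple of operators on $\mathscr{H}\oplus\mathscr{H}$ with $k$-th component $\begin{bmatrix}A_k&C_k^*\\ C_k&B_k\end{bmatrix}$. *)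

(* Defs.v *)
From HB Require Import structures.
From mathcomp Require Import all_boot all_order all_algebra.
From mathcomp Require Import all_classical all_reals all_analysis complex.

Set Implicit Arguments.
Unset Strict Implicit.
Unset Printing Implicit Defensive.

Import Order.TTheory GRing.Theory Num.Theory numFieldNormedType.Exports.

Local Open Scope classical_set_scope.
Local Open Scope ring_scope.

Section DotTheory.
Variables (C : numClosedFieldType) (U : lmodType C).
Variable dot : {dot U for @Num.conj C}.
Implicit Types u v : U.

Lemma dot_sub_proj u v : v != 0 ->
  dot (u - (dot u v / dot v v) *: v) (u - (dot u v / dot v v) *: v)
  = dot u u - `|dot u v| ^+ 2 / dot v v.
Proof.
move=> v0; have d0 : dot v v != 0 by rewrite dnorm_eq0.
set c := _ / _.
have ortho : dot (u - c *: v) v = 0.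
  by rewrite linearBl/= linearZl_LR/= /c divfK// subrr.
rewrite {1}linearBr/= linearZr_LR/= ortho mulr0 subr0 linearBl/= linearZl_LR/=.
by congr (_ - _); rewrite [dot v u]hermC/= expr0 mul1r /c mulrAC normCK.
Qed.

Lemma dot_cauchy_schwarz u v : `|dot u v| ^+ 2 <= dot u u * dot v v.
Proof.
have [->|v0] := eqVneq v 0; first by rewrite !linear0r normr0 expr0n/= ?mulr0.
by rewrite -ler_pdivrMr ?dnorm_gt0// -subr_ge0 -dot_sub_proj// dnorm_ge0.
Qed.

Lemma dot_norm_cauchy_schwarz u v :
  `|dot u v| <= sqrtC (dot u u) * sqrtC (dot v v).
Proof.
rewrite -sqrtCM ?nnegrE ?dnorm_ge0// -(sqrCK (normr_ge0 _)).
by rewrite ler_sqrtC ?nnegrE ?exprn_ge0// ?mulr_ge0 ?dnorm_ge0//;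
  exact: dot_cauchy_schwarz.
Qed.

Lemma dot_norm_triangle u v :
  sqrtC (dot (u + v) (u + v)) <= sqrtC (dot u u) + sqrtC (dot v v).
Proof.
have g0 w : 0 <= sqrtC (dot w w) by rewrite sqrtC_ge0 dnorm_ge0.
rewrite -[leRHS]sqrCK ?addr_ge0// ler_sqrtC ?nnegrE ?dnorm_ge0 ?exprn_ge0 ?addr_ge0//.
rewrite sqrrD !sqrtCK dnormD/= addrAC lerD2r lerD2l.
apply: (@le_trans _ _ (`|dot u v| + `|(dot u v)^*|)); last first.
  by rewrite norm_conjC -mulr2n lerMn2r/= dot_norm_cauchy_schwarz.
rewrite (le_trans _ (ler_normD _ _))// real_ler_norm// CrealE rmorphD/= conjCK.
by rewrite addrC.
Qed.

Lemma dot_normZ (a : C) u :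
  sqrtC (dot (a *: u) (a *: u)) = `|a| * sqrtC (dot u u).
Proof.
by rewrite dnormZ sqrtCM ?nnegrE ?exprn_ge0 ?dnorm_ge0// sqrCK.
Qed.

Lemma dot_norm_eq0 u : sqrtC (dot u u) = 0 -> u = 0.
Proof. by move=> /eqP; rewrite sqrt_dnorm_eq0 => /eqP. Qed.

Lemma dot_sym u v : dot u v = (dot v u)^*.
Proof. by rewrite hermC/= expr0 mul1r. Qed.

Lemma dot_eqr u v : (forall w, dot w u = dot w v) -> u = v.
Proof.
move=> h; apply/eqP; rewrite -subr_eq0 -(dnorm_eq0 dot) linearBr/=.
by rewrite h subrr.
Qed.

End DotTheory.

(* The inner product is linear in its first argument and conjugate-linear in
   the second one. *)
HB.mixin Record CompleteNormedModule_isHilbert (R : realType) H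
    & CompleteNormedModule R[i] H := {
  inner : {dot H for @Num.conj R[i]};
  innerE : forall x : H, inner x x = `|x| ^+ 2
}.

#[short(type="hilbertType")]
HB.structure Definition Hilbert (R : realType) :=
  {H of CompleteNormedModule R[i] H & CompleteNormedModule_isHilbert R H}.

Arguments inner {R s}.

Section HilbertTheory.
Variables (R : realType) (H : hilbertType R).
Implicit Types x y : H.

Lemma hnormE x : `|x| = sqrtC (inner x x).
Proof. by rewrite innerE sqrCK. Qed.

Lemma cauchy_schwarz x y : `|inner x y| <= `|x| * `|y|.
Proof. by rewrite !hnormE; exact: dot_norm_cauchy_schwarz. Qed.

Lemma parallelogram x y :
  `|x + y| ^+ 2 + `|x - y| ^+ 2 = 2 * `|x| ^+ 2 + 2 * `|y| ^+ 2.
Proof.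
rewrite -!innerE dnormD dnormB/= addrACA subrr addr0.
by rewrite !mulr_natl !mulr2n addrACA.
Qed.

End HilbertTheory.

Section Riesz.
Variables (R : realType) (H : hilbertType R).
Variables (f : {scalar H}) (M : R[i]).
Hypothesis fM : forall x, `|f x| <= M * `|x|.

Let A (e : R[i]) : set H :=
  [set x | f x = 1 /\ forall v, f v = 1 -> `|x| ^+ 2 <= `|v| ^+ 2 + e ^+ 2].

Let A_neq0 (x0 : H) (e : R[i]) : f x0 = 1 -> 0 < e -> A e !=set0.
Proof.
move=> fx0 e0.
pose E := [set complex.Re (`|v| ^+ 2) | v in [set v | f v = 1]].
have nR (v : H) : (complex.Re (`|v| ^+ 2))%:C%C = `|v| ^+ 2.
  by rewrite RRe_real// rpredX// normr_real.
have hE : has_inf E.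
  split; first by exists (complex.Re (`|x0| ^+ 2)), x0.
  exists 0 => _ [v _ <-]; rewrite -lecR nR exprn_ge0//.
have eR : (complex.Re (e ^+ 2))%:C%C = e ^+ 2 by rewrite RRe_real ?rpredX ?gtr0_real.
have Re0 : 0 < complex.Re (e ^+ 2) by rewrite -ltcR eR exprn_gt0.
have [_ [x fx <-] xe] := inf_adherent Re0 hE.
exists x; split=> // v fv; rewrite -nR -[X in _ <= X + _]nR -eR -rmorphD lecR.
rewrite (le_trans (ltW xe))// lerD2r; apply: ge_inf; first by case: hE.
by exists v.
Qed.

Let A_close e x w : 0 < e -> A e x -> A e w -> `|x - w| <= 2 * e.
Proof.
move=> e0 [fx hx] [fw hw].
rewrite -(@ler_pXn2r _ 2)// ?nnegrE ?mulr_ge0 ?(ltW e0)//.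
have f2 : f (2^-1 *: (x + w)) = 1.
  by rewrite linearZ linearD/= fx fw mulVf.
have le2 := lerD (hx _ f2) (hw _ f2).
rewrite normrZ exprMn -(ler_pM2l (x := 2))// in le2.
have := parallelogram x w => /(canRL (addKr _)) ->.
rewrite [leLHS]addrC lerBlDr -mulrDr (le_trans le2)//.
rewrite ger0_norm// exprVn exprMn.
set p := `|_| ^+ 2.
suff -> : 2 * (2 ^- 2 * p + e ^+ 2 + (2 ^- 2 * p + e ^+ 2)) = 2 ^+ 2 * e ^+ 2 + p by [].
rewrite -mulr2n -[X in _ * X]mulr_natl mulrA -expr2 mulrDr mulrA mulfV ?expf_neq0//.
by rewrite mul1r addrC.
Qed.

Let A_ortho e x z : 0 < e -> A e x -> f z = 0 -> `|inner x z| <= e * `|z|.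
Proof.
move=> e0 [fx hx] fz; have [->|z0] := eqVneq z 0.
  by rewrite linear0r !normr0 mulr0.
rewrite -(@ler_pXn2r _ 2)// ?nnegrE ?mulr_ge0 ?(ltW e0)//.
have := hx (x - (inner x z / inner z z) *: z).
rewrite linearB linearZ/= fx fz mulr0 subr0 => /(_ erefl).
rewrite -!innerE dot_sub_proj// addrAC lerBrDr lerD2l.
by rewrite ler_pdivrMr ?dnorm_gt0// innerE -exprMn.
Qed.

Let small0 (a b : R[i]) : 0 <= b -> (forall e, 0 < e -> `|a| <= b * e) -> a = 0.
Proof.
move=> b0 h; apply/eqP; apply: contraT; rewrite -normr_gt0 => a0.
have B0 : 0 < 2 * b + 1 by rewrite ltr_wpDl// mulr_ge0.
have /h : 0 < `|a| / (2 * b + 1) by rewrite divr_gt0.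
rewrite mulrCA ler_pMr// ler_pdivlMr// mul1r mulr_natl mulr2n -addrA gerDl.
by move=> /(lt_le_trans (ltr_wpDl b0 ltr01)); rewrite ltxx.
Qed.

Lemma riesz : exists y, forall x, f x = inner x y.
Proof.
have [f0|/existsNP[x1 /eqP fx1]] := pselect (forall x, f x = 0).
  by exists 0 => x; rewrite linear0r.
pose x0 := (f x1)^-1 *: x1.
have fx0 : f x0 = 1 by rewrite linearZ/= mulVf.
have M0 : 0 <= M.
  have x10 : 0 < `|x1|.
    by rewrite normr_gt0; apply: contraNneq fx1 => ->; rewrite linear0.
  by rewrite -(pmulr_lge0 _ x10) (le_trans _ (fM _)).
pose F := filter_from [set e : R[i] | 0 < e] A.
have FF : ProperFilter F.
  apply: filter_from_proper; last by move=> e /= e0; exact: A_neq0 fx0 e0.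
  apply: filter_from_filter; first by exists 1 => /=.
  move=> e1 e2 /= e10 e20.
  have le_A a b : 0 < a -> 0 < b -> a <= b -> A a `<=` A b.
    move=> a0 b0 ab x [fx hx]; split=> // v fv; rewrite (le_trans (hx _ fv))//.
    by rewrite lerD2l ler_pXn2r// nnegrE ltW.
  have [e12|/ltW e21] := real_leP (gtr0_real e10) (gtr0_real e20).
    by exists e1 => // x Ax; split=> //; exact: le_A Ax.
  by exists e2 => // x Ax; split=> //; exact: le_A Ax.
have cF : cvg F.
  apply: cauchy_cvg; apply: cauchy_exP => e e0.
  have e4 : 0 < e / 4 by rewrite divr_gt0.
  have [x Ax] := A_neq0 fx0 e4.
  exists x, (e / 4) => // w Aw; rewrite -ball_normE/=.
  rewrite (le_lt_trans (A_close e4 Ax Aw))//.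
  by rewrite mulrCA gtr_pMr// ltr_pdivrMr// mul1r ltr_nat.
pose y := lim F.
have near_y e : 0 < e -> exists x, A e x /\ `|y - x| < e.
  move=> e0; have : F (ball y e) by exact: (cF _ (nbhsx_ballx y e e0)).
  rewrite -ball_normE/= => yF.
  have : F (A e `&` [set x | `|y - x| < e]).
    by apply: filterI => //; exists e.
  by move=> /filter_ex[x [Ax xy]]; exists x.
have fy : f y = 1.
  apply/eqP; rewrite -subr_eq0; apply/eqP; apply: (@small0 _ M) => // e e0.
  have [x [[fx _] xy]] := near_y _ e0.
  by rewrite -fx -linearB (le_trans (fM _))// ler_wpM2l// ltW.
have oy z : f z = 0 -> inner y z = 0.
  move=> fz; apply: (@small0 _ (2 * `|z|)); first by rewrite mulr_ge0.
  move=> e e0; have [x [Ax xy]] := near_y _ e0.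
  rewrite -(subrK x y) linearDl/= (le_trans (ler_normD _ _))//.
  rewrite -mulrA mulr_natl mulr2n [`|z| * _]mulrC.
  apply: lerD; last exact: A_ortho.
  by rewrite (le_trans (cauchy_schwarz _ _))// ler_wpM2r// ltW.
have y0 : inner y y != 0.
  by rewrite dnorm_eq0; apply: contraTneq isT => y0; move/eqP: fy;
     rewrite y0 linear0 eq_sym oner_eq0.
exists ((inner y y)^-1 *: y) => x.
have /oy : f (x - f x *: y) = 0 by rewrite linearB linearZ/= fy mulr1 subrr.
rewrite dot_sym => /eqP; rewrite conjC_eq0 linearBl/= linearZl_LR/= subr_eq0.
move=> /eqP xy; rewrite linearZr_LR/= xy fmorphV/=.
by rewrite -dot_sym mulrC mulfK.
Qed.

End Riesz.

Section BoundedOperators.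
Variables (R : realType) (H : hilbertType R).

Record bop : Type := Bop {
  bop_fun :> H -> H;
  bop_linear : linear bop_fun;
  bop_bounded : exists M : R[i], forall x, `|bop_fun x| <= M * `|x|
}.

HB.instance Definition _ := gen_eqMixin bop.
HB.instance Definition _ := gen_choiceMixin bop.

HB.instance Definition _ (T : bop) :=
  GRing.isLinear.Build R[i] H H *:%R T (bop_linear T).

Lemma bopP (S T : bop) : S =1 T -> S = T.
Proof.
case: S T => [S lS bS] [T lT bT] /= /funext eqST; case: _ / eqST in lT bT *.
by congr Bop; exact: Prop_irrelevance.
Qed.

Lemma bop_gt0_bound (T : bop) :
  exists2 M : R[i], 0 < M & forall x, `|T x| <= M * `|x|.
Proof.
have [M TM] := bop_bounded T; exists (`|M| + 1); first by rewrite ltr_wpDl.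
move=> x; have [->|x0] := eqVneq x 0; first by rewrite linear0 !normr0 mulr0.
have M0 : 0 <= M.
  by rewrite -(@pmulr_lge0 _ `|x|) ?normr_gt0// (le_trans _ (TM _)).
by rewrite (le_trans (TM _))// ler_wpM2r// (ger0_norm M0) lerDl.
Qed.

Lemma bop_continuous (T : bop) : continuous T.
Proof.
have [M M0 TM] := bop_gt0_bound T.
apply: bounded_linear_continuous; apply/linear_boundedP.
exists M; split; first exact: gtr0_real.
by move=> r /ltW Mr x; rewrite (le_trans (TM x))// ler_wpM2r.
Qed.

Section operations.
Implicit Types S T : bop.

Let add_linear S T : linear (fun x => S x + T x).
Proof. by move=> a x y; rewrite !linearP addrACA -scalerDr. Qed.

Let add_bounded S T :
  exists M : R[i], forall x, `|S x + T x| <= M * `|x|.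
Proof.
have [[M SM] [N TN]] := (bop_bounded S, bop_bounded T).
exists (M + N) => x; rewrite (le_trans (ler_normD _ _))// mulrDl.
exact: lerD.
Qed.

Let opp_linear T : linear (fun x => - T x).
Proof. by move=> a x y; rewrite linearP opprD scalerN. Qed.

Let opp_bounded T : exists M : R[i], forall x, `|- T x| <= M * `|x|.
Proof. by have [M TM] := bop_bounded T; exists M => x; rewrite normrN. Qed.

Let zero_linear : linear (fun _ : H => 0 : H).
Proof. by move=> a x y; rewrite scaler0 addr0. Qed.

Let zero_bounded : exists M : R[i], forall x : H, `|0 : H| <= M * `|x|.
Proof. by exists 0 => x; rewrite normr0 mul0r. Qed.

Let comp_linear S T : linear (fun x => S (T x)).
Proof. by move=> a x y; rewrite !linearP. Qed.

Let comp_bounded S T : exists M : R[i], forall x, `|S (T x)| <= M * `|x|.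
Proof.
have [[M M0 SM] [N _ TN]] := (bop_gt0_bound S, bop_gt0_bound T).
exists (M * N) => x; rewrite (le_trans (SM _))// -mulrA ler_pM2l//.
Qed.

Let id_linear : linear (fun x : H => x).
Proof. by []. Qed.

Let id_bounded : exists M : R[i], forall x : H, `|x| <= M * `|x|.
Proof. by exists 1 => x; rewrite mul1r. Qed.

Definition bop_add S T := Bop (add_linear S T) (add_bounded S T).
Definition bop_opp T := Bop (opp_linear T) (opp_bounded T).
Definition bop_zero := Bop zero_linear zero_bounded.
Definition bop_comp S T := Bop (comp_linear S T) (comp_bounded S T).
Definition bop_id := Bop id_linear id_bounded.

End operations.

Let bop_addA : associative bop_add.
Proof. by move=> S T U; apply: bopP => x /=; rewrite addrA. Qed.
Let bop_addC : commutative bop_add.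
Proof. by move=> S T; apply: bopP => x /=; rewrite addrC. Qed.
Let bop_add0 : left_id bop_zero bop_add.
Proof. by move=> S; apply: bopP => x /=; rewrite add0r. Qed.
Let bop_addN : left_inverse bop_zero bop_opp bop_add.
Proof. by move=> S; apply: bopP => x /=; rewrite addNr. Qed.
Let bop_compA : associative bop_comp.
Proof. by move=> S T U; apply: bopP. Qed.
Let bop_comp1 : left_id bop_id bop_comp.
Proof. by move=> S; apply: bopP. Qed.
Let bop_compr1 : right_id bop_id bop_comp.
Proof. by move=> S; apply: bopP. Qed.
Let bop_compDl : left_distributive bop_comp bop_add.
Proof. by move=> S T U; apply: bopP. Qed.
Let bop_compDr : right_distributive bop_comp bop_add.
Proof. by move=> S T U; apply: bopP => x /=; rewrite linearD. Qed.

HB.instance Definition _ :=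
  GRing.isZmodule.Build bop bop_addA bop_addC bop_add0 bop_addN.
HB.instance Definition _ := GRing.Zmodule_isPzRing.Build bop
  bop_compA bop_comp1 bop_compr1 bop_compDl bop_compDr.

Lemma bop_addE (S T : bop) x : (S + T) x = S x + T x. Proof. by []. Qed.
Lemma bop_mulE (S T : bop) x : (S * T) x = S (T x). Proof. by []. Qed.

Lemma bop_sumE (I : Type) (r : seq I) (P : pred I) (T : I -> bop) x :
  (\sum_(i <- r | P i) T i) x = \sum_(i <- r | P i) T i x.
Proof.
exact: (big_morph (fun S : bop => S x) (fun S T => bop_addE S T x) erefl).
Qed.

Lemma adjoint_ex (T : bop) :
  exists S : bop, forall x y, inner (T x) y = inner x (S y).
Proof.
have [M M0 TM] := bop_gt0_bound T.
have repr y : exists s, forall x, inner (T x) y = inner x s.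
  pose f x := inner (T x) y.
  have fL : linear_for *%R f.
    by move=> a u v; rewrite /f linearP/= linearDl/= linearZl_LR.
  pose F : {scalar H} := HB.pack f (GRing.isLinear.Build _ _ _ _ f fL).
  apply: (@riesz R H F (M * `|y|)) => x /=.
  by rewrite (le_trans (cauchy_schwarz _ _))// mulrAC ler_wpM2r.
have [S TS] := choice repr.
have S_linear : linear S.
  move=> a u v; apply: (dot_eqr (dot := inner)) => w.
  by rewrite linearDr linearZr_LR/= -!TS linearDr linearZr_LR.
have S_bounded : exists N : R[i], forall x, `|S x| <= N * `|x|.
  exists M => y; have [->|Sy0] := eqVneq (S y) 0.
    by rewrite normr0 mulr_ge0// ltW.
  rewrite -(@ler_pM2l _ `|S y|) ?normr_gt0// -expr2 -innerE -TS.
  have /real_ler_norm/le_trans -> // : inner (T (S y)) y \is Num.real.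
    by rewrite TS innerE realE exprn_ge0.
  by rewrite (le_trans (cauchy_schwarz _ _))// mulrA ler_wpM2r// mulrC.
by exists (Bop S_linear S_bounded).
Qed.

Definition adjoint (T : bop) : bop := projT1 (cid (adjoint_ex T)).

Lemma adjointE (T : bop) x y : inner (T x) y = inner x (adjoint T y).
Proof. by rewrite /adjoint; case: cid. Qed.

(* In R[i], [0 <= z] says that z is real and nonnegative. *)
Definition positive_op (T : bop) : Prop := forall x, 0 <= inner (T x) x.

Definition positive_tuple (d : nat) (T : 'I_d -> bop) : Prop :=
  forall k, positive_op (T k).

(* Norms and moduli over R[i] are real elements of R[i]: complex.Re casts them
   to R, where suprema are taken.  When H = {0} the unit sphere is empty and the
   suprema are 0. *)
Definition unit_sphere : set H := [set x | `|x| = 1].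

Definition op_norm (T : bop) : R :=
  sup [set complex.Re `|T x| | x in unit_sphere].

Definition euclidean_radius (d : nat) (T : 'I_d -> bop) : R :=
  sup [set Num.sqrt (\sum_(k < d) complex.Re `|inner (T k x) x| ^+ 2)
      | x in unit_sphere].

Definition euclidean_norm (d : nat) (T : 'I_d -> bop) : R :=
  sup [set Num.sqrt (\sum_(k < d) complex.Re `|T k x| ^+ 2)
      | x in unit_sphere].

End BoundedOperators.

(* An alias of the product type, which carries the max norm; hsum H K carries
   the Hilbert norm instead. *)
Definition hsum (R : realType) (H K : hilbertType R) : Type := (H * K)%type.

Section HilbertSum.
Variables (R : realType) (H K : hilbertType R).
Local Notation HK := (hsum H K).

HB.instance Definition _ := GRing.Lmodule.copy HK (H * K)%type.

Definition hsum_inner (u v : HK) : R[i] := inner u.1 v.1 + inner u.2 v.2.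

Let hsum_inner_linearl v : linear_for *%R (hsum_inner ^~ v).
Proof.
move=> a u w; rewrite /hsum_inner/= !linearDl/= !linearZl_LR/= mulrDr.
by rewrite addrACA.
Qed.

Let hsum_inner_linearr u : linear_for (@Num.conj R[i] \; *%R) (hsum_inner u).
Proof.
move=> a v w; rewrite /hsum_inner/= !linearDr/= !linearZr_LR/=.
by rewrite addrACA.
Qed.

HB.instance Definition _ := bilinear_isBilinear.Build R[i] HK HK R[i]
  *%R (@Num.conj R[i] \; *%R) hsum_inner (hsum_inner_linearl, hsum_inner_linearr).

Let hsum_inner_herm u v :
  hsum_inner u v = (-1) ^+ false * (hsum_inner v u)^*.
Proof. by rewrite expr0 mul1r /hsum_inner rmorphD/= -!dot_sym. Qed.

HB.instance Definition _ := isHermitianSesquilinear.Build R[i] HK false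
  (@Num.conj R[i]) hsum_inner hsum_inner_herm.

Let hsum_inner_gt0 (u : HK) : u != 0 -> 0 < hsum_inner u u.
Proof.
case: u => x y; rewrite -pair_eqE negb_and/= => xy.
rewrite lt_def addr_ge0 ?dnorm_ge0// andbT paddr_eq0 ?dnorm_ge0//.
by rewrite !dnorm_eq0 negb_and.
Qed.

HB.instance Definition _ := isDotProduct.Build R[i] HK hsum_inner hsum_inner_gt0.

Let hsum_norm (u : HK) : R[i] := sqrtC (hsum_inner u u).

HB.instance Definition _ := Lmodule_isNormed.Build R[i] HK
  (dot_norm_triangle hsum_inner) (dot_normZ hsum_inner) (@dot_norm_eq0 _ _ hsum_inner).

Lemma hsum_normE (u : HK) : `|u| = sqrtC (`|u.1| ^+ 2 + `|u.2| ^+ 2).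
Proof. by rewrite -!innerE. Qed.

Lemma hsum_norm1 (u : HK) : `|u.1| <= `|u|.
Proof.
rewrite hsum_normE -[leLHS]sqrCK// ler_sqrtC ?nnegrE ?addr_ge0 ?exprn_ge0//.
by rewrite lerDl exprn_ge0.
Qed.

Lemma hsum_norm2 (u : HK) : `|u.2| <= `|u|.
Proof.
rewrite hsum_normE -[leLHS]sqrCK// ler_sqrtC ?nnegrE ?addr_ge0 ?exprn_ge0//.
by rewrite lerDr exprn_ge0.
Qed.

Lemma hsum_norm_le (u : HK) : `|u| <= `|u.1| + `|u.2|.
Proof.
rewrite hsum_normE -[leRHS]sqrCK ?addr_ge0//.
rewrite ler_sqrtC ?nnegrE ?addr_ge0 ?exprn_ge0 ?addr_ge0//.
by rewrite sqrrD addrAC lerDl mulrn_wge0// mulr_ge0.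
Qed.

Let hsum_complete (F : set_system HK) : ProperFilter F -> cauchy F -> cvg F.
Proof.
move=> FF /cauchyP cF.
have c1 : cvg ((fun u : HK => u.1) @ F).
  apply: cauchy_cvg; apply: cauchy_exP => e /cF[u Fu].
  exists u.1; apply: (@filterS _ F _ (ball u e)) => // v; rewrite -!ball_normE/=.
  exact: le_lt_trans (hsum_norm1 (u - v)).
have c2 : cvg ((fun u : HK => u.2) @ F).
  apply: cauchy_cvg; apply: cauchy_exP => e /cF[u Fu].
  exists u.2; apply: (@filterS _ F _ (ball u e)) => // v; rewrite -!ball_normE/=.
  exact: le_lt_trans (hsum_norm2 (u - v)).
pose a := lim ((fun u : HK => u.1) @ F); pose b := lim ((fun u : HK => u.2) @ F).
apply/cvg_ex; exists ((a, b) : HK) => P /nbhs_normP[e /= e0 eP].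
have e2 : 0 < e / 2 by rewrite divr_gt0.
have Fa : F [set u : HK | ball a (e / 2) u.1] by exact: c1 (nbhsx_ballx a _ e2).
have Fb : F [set u : HK | ball b (e / 2) u.2] by exact: c2 (nbhsx_ballx b _ e2).
apply: (filterS _ (filterI Fa Fb)) => u /=; rewrite -!ball_normE/= => -[ua ub].
apply: eP => /=; rewrite (le_lt_trans (hsum_norm_le _))// [e]splitr.
exact: ltrD.
Qed.

HB.instance Definition _ := Uniform_isComplete.Build HK hsum_complete.

Let hsum_innerE (u : HK) : hsum_inner u u = `|u| ^+ 2.
Proof. by rewrite sqrtCK. Qed.

HB.instance Definition _ :=
  CompleteNormedModule_isHilbert.Build R HK hsum_innerE.

Lemma hsum_innerD (u v : HK) : inner u v = inner u.1 v.1 + inner u.2 v.2.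
Proof. by []. Qed.

End HilbertSum.

Section Block.
Variables (R : realType) (H : hilbertType R).
Variables A B C D : bop H.

Let block_fun (u : hsum H H) : hsum H H := (A u.1 + B u.2, C u.1 + D u.2).

Let block_linear : linear block_fun.
Proof.
move=> a u v; rewrite /block_fun/=; congr pair;
  by rewrite !linearP addrACA -scalerDr.
Qed.

Let block_bounded : exists M : R[i], forall u, `|block_fun u| <= M * `|u|.
Proof.
have [MA MA0 hA] := bop_gt0_bound A; have [MB MB0 hB] := bop_gt0_bound B.
have [MC MC0 hC] := bop_gt0_bound C; have [MD MD0 hD] := bop_gt0_bound D.
exists (MA + MB + (MC + MD)) => u; rewrite (le_trans (hsum_norm_le _))//= !mulrDl.
apply: lerD; rewrite (le_trans (ler_normD _ _))//; apply: lerD.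
- by rewrite (le_trans (hA _))// ler_pM2l// hsum_norm1.
- by rewrite (le_trans (hB _))// ler_pM2l// hsum_norm2.
- by rewrite (le_trans (hC _))// ler_pM2l// hsum_norm1.
- by rewrite (le_trans (hD _))// ler_pM2l// hsum_norm2.
Qed.

Definition block_op : bop (hsum H H) := Bop block_linear block_bounded.

Lemma block_opE (u : hsum H H) :
  block_op u = (A u.1 + B u.2, C u.1 + D u.2) :> hsum H H.
Proof. by []. Qed.

End Block.

(* Main.v *)
Require Import Defs.
From mathcomp Require Import all_boot all_order all_algebra.
From mathcomp Require Import all_classical all_reals all_analysis complex.
From mathcomp Require Import ring lra.

Set Implicit Arguments.
Unset Strict Implicit.
Unset Printing Implicit Defensive.

Import Order.TTheory GRing.Theory Num.Theory numFieldNormedType.Exports.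

Local Open Scope ring_scope.

(** For a unit vector [x], positivity of the block operator with entries [A],
    [C^*], [C], [B] says that a Hermitian form on the plane is positive
    semidefinite, whence [|<Cx,x>|^2 <= <Ax,x> <Bx,x>] (the nonnegative
    determinant of that form, [block_positive_form]).  So, after summation over
    the components, only the right-hand sides [sum_k <A_k x,x> <B_k x,x>] have
    to be estimated, uniformly in [x].

    - For (i), the arithmetic-geometric inequality bounds each product by
      [(<Ax,x>^2 + <Bx,x>^2) / 2 <= (|Ax|^2 + |Bx|^2) / 2], and since [A] and
      [B] are selfadjoint, [sum_k (|A_k x|^2 + |B_k x|^2)] is the value at [x]
      of the quadratic form of [sum_k (A_k^2 + B_k^2)]
      ([sum_sqr_norm_le_op_norm]).

    - For (ii) and (iii), Buzano's inequality ([buzano]) is used instead: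
      [2 <Ax,x> <x,Bx> <= |Ax| |Bx| + |<Ax,Bx>|], where [<Ax,Bx>] is the
      conjugate of [<ABx,x>].  The numbers [|<A_k B_k x,x>|] add up to at most
      [sqrt d * w_e(AB)] by Cauchy-Schwarz against the constant family [1].
      The products [|A_k x| |B_k x|] are summed by Cauchy-Schwarz in (ii), and
      by the arithmetic-geometric inequality, as in (i), in (iii). *)

(* Norms and moduli are real elements of R[i], while the sums, square roots and
   suprema to be compared live in R. *)
Local Notation cabs z := (complex.Re `|z|).

(** * Finite sums of real numbers *)

Section FiniteSums.
Variables (R : rcfType) (I : finType).
Implicit Types a b : I -> R.

(** Twice the difference of the two sides is the double sum of the squares
    [(a i * b j - a j * b i) ^+ 2] (Lagrange's identity). *)
Lemma sum_cauchy_schwarz a b :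
  (\sum_i a i * b i) ^+ 2 <= (\sum_i a i ^+ 2) * (\sum_i b i ^+ 2).
Proof.
have swap : (\sum_i a i ^+ 2) * (\sum_i b i ^+ 2)
    = \sum_i \sum_j a j ^+ 2 * b i ^+ 2.
  by rewrite mulrC big_distrlr/=; under eq_bigr do under eq_bigr do rewrite mulrC.
suff : (\sum_i a i * b i) ^+ 2 + (\sum_i a i * b i) ^+ 2
    <= \sum_i \sum_j a i ^+ 2 * b j ^+ 2 + \sum_i \sum_j a j ^+ 2 * b i ^+ 2.
  by rewrite -swap big_distrlr/=; lra.
rewrite expr2 big_distrlr/= -!big_split/=; apply: ler_sum => i _.
rewrite -!big_split/=; apply: ler_sum => j _.
by have := sqr_ge0 (a i * b j - a j * b i); lra.
Qed.

Lemma sum_mul_le_sqrt a b :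
  \sum_i a i * b i
  <= Num.sqrt (\sum_i a i ^+ 2) * Num.sqrt (\sum_i b i ^+ 2).
Proof.
rewrite (le_trans (ler_norm _))// -sqrtr_sqr -sqrtrM ?ler_wsqrtr//.
  exact: sum_cauchy_schwarz.
by apply: sumr_ge0 => i _; exact: sqr_ge0.
Qed.

Lemma sqrt_sum_sqr_le a b : (forall i, 0 <= a i <= b i) ->
  Num.sqrt (\sum_i a i ^+ 2) <= Num.sqrt (\sum_i b i ^+ 2).
Proof.
move=> ab; apply/ler_wsqrtr/ler_sum => i _; have /andP[a0 abi] := ab i.
by rewrite ler_pXn2r// nnegrE (le_trans a0).
Qed.

End FiniteSums.

(** * Moduli and Hermitian forms over the complex numbers *)

Section ComplexModulus.
Variable R : realType.

Lemma cabsE (V : normedZmodType R[i]) (v : V) : (cabs v)%:C%C = `|v|.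
Proof. by rewrite RRe_real// ger0_real. Qed.

Lemma cabs_ge0 (V : normedZmodType R[i]) (v : V) : 0 <= cabs v.
Proof. by rewrite -lecR cabsE normr_ge0. Qed.

Lemma realcD (a b : R) : (a + b)%:C%C = a%:C%C + b%:C%C.
Proof. exact: rmorphD. Qed.

Lemma realcM (a b : R) : (a * b)%:C%C = a%:C%C * b%:C%C.
Proof. exact: rmorphM. Qed.

Lemma realcX (a : R) n : (a ^+ n)%:C%C = a%:C%C ^+ n.
Proof. exact: rmorphXn. Qed.

End ComplexModulus.

(** If [b] is nonzero, the form is minimal at [c = - z / b], where its value is
    [a - |z|^2 / b].  If [b = 0], it is real-affine in [c], hence bounded below
    only when [z = 0]. *)
Lemma psd_form_det (C : numClosedFieldType) (a b z : C) : 0 <= a -> 0 <= b ->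
  (forall c : C, 0 <= a + c * z^* + c^* * z + `|c| ^+ 2 * b) ->
  `|z| ^+ 2 <= a * b.
Proof.
move=> a0 b0 h.
(* The form along the line [c = - t z], [t] real. *)
have key (t : C) : t \is Num.real ->
    0 <= a - 2 * t * `|z| ^+ 2 + t ^+ 2 * `|z| ^+ 2 * b.
  move=> tr; have := h (- t * z).
  rewrite rmorphM rmorphN/= (CrealP tr) normrM normrN exprMn real_normK// normCK.
  by congr (0 <= _); ring.
have [b00|bn0] := eqVneq b 0; last first.
  have bp : 0 < b by rewrite lt_def bn0.
  have := key b^-1; rewrite realV gtr0_real// => /(_ isT).
  rewrite -(pmulr_rge0 _ bp).
  have -> : b * (a - 2 * b^-1 * `|z| ^+ 2 + b^-1 ^+ 2 * `|z| ^+ 2 * b)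
    = a * b - `|z| ^+ 2 by field.
  by rewrite subr_ge0.
rewrite b00 mulr0; apply: contraT => z2.
have zn0 : `|z| != 0 by apply: contraNneq z2 => ->; rewrite expr0n.
(* This value of [t] makes the affine function [a - 2 t |z|^2] equal to -1. *)
have := key ((a + 1) / (2 * `|z| ^+ 2)); rewrite ger0_real; last first.
  by rewrite divr_ge0 ?addr_ge0 ?mulr_ge0 ?exprn_ge0.
move=> /(_ isT).
have -> : a - 2 * ((a + 1) / (2 * `|z| ^+ 2)) * `|z| ^+ 2
   + ((a + 1) / (2 * `|z| ^+ 2)) ^+ 2 * `|z| ^+ 2 * b = -1.
  by rewrite b00; field.
by rewrite ler0N1.
Qed.

(** * Positive operators *)

Section Hilbert.
Variables (R : realType) (H : hilbertType R).
Implicit Types (x y e : H) (T A B : bop H).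

(** Evaluating the block operator at [(x, c *: y)] gives, as a function of the
    scalar [c], a positive semidefinite form with off-diagonal entry
    [inner (C x) y]. *)
Lemma block_positive_form A B C x y :
  positive_op A -> positive_op B ->
  positive_op (block_op A (adjoint C) C B) ->
  `|inner (C x) y| ^+ 2 <= inner (A x) x * inner (B y) y.
Proof.
move=> pA pB pM; apply: psd_form_det => // c.
have := pM (x, c *: y).
rewrite hsum_innerD/= [adjoint C _]linearZ [B _]linearZ/= !linearDl/= !linearZl_LR/=.
rewrite !linearZr_LR/= [inner (adjoint C y) x]dot_sym -adjointE normCK.
(* Scaling on the right leaves a module action of R[i] on itself. *)
rewrite /GRing.scale/=.
by congr (0 <= _); ring.
Qed.

(** Polarization: [inner (T (x + c *: y)) (x + c *: y)] is real for every scalar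
    [c], and the cases [c = 1] and [c = 'i] determine [inner (T y) x]. *)
Lemma positive_op_selfadjoint T x y :
  positive_op T -> inner (T x) y = inner x (T y).
Proof.
move=> pT; rewrite [RHS]dot_sym.
have re u : (inner (T u) u)^* = inner (T u) u by apply/CrealP/ger0_real.
set p := inner (T x) y; set q := inner (T y) x.
have sym c : c * p^* + c^* * q^* = c^* * p + c * q.
  have eT : inner (T (x + c *: y)) (x + c *: y)
      = inner (T x) x + `|c| ^+ 2 * inner (T y) y + (c^* * p + c * q).
    rewrite [T (_ + _)]linearD/= [T (_ *: _)]linearZ/= !linearDl/= !linearDr/= !linearZl_LR/=.
    by rewrite !linearZr_LR/= /GRing.scale/= normCK /p /q; ring.
  have := re (x + c *: y); rewrite eT rmorphD rmorphD/= re rmorphM/= re.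
  rewrite rmorphXn/= conj_normC => /addrI <-.
  by rewrite rmorphD !rmorphM/= conjCK.
have := sym 1; have := sym 'i; rewrite conjCi conjC1 !mul1r.
rewrite !mulNr -[- _ + _]addrC -!mulrBr => /(mulfI (neq0Ci _)) dif sum.
apply: (mulfI (_ : 2 != 0 :> R[i])); first by rewrite pnatr_eq0.
transitivity ((p + q) - (q - p)); first by ring.
by rewrite -sum -dif; ring.
Qed.

Lemma cabs_inner_le T x : `|x| = 1 -> cabs (inner (T x) x) <= cabs (T x).
Proof.
move=> x1; rewrite -lecR !cabsE (le_trans (cauchy_schwarz _ _))//.
by rewrite x1 mulr1.
Qed.

(** Buzano's inequality.  The vector [r = 2 <x,e> e - x] is the reflection of
    [x] across the line of [e], so [|r| = |x|]; Cauchy-Schwarz for [r] and [y]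
    gives the claim, because [2 <x,e> <e,y> = <r,y> + <x,y>]. *)
Lemma buzano x y e : `|e| = 1 ->
  2 * `|inner x e * inner e y| <= `|x| * `|y| + `|inner x y|.
Proof.
move=> e1; have ee : inner e e = 1 by rewrite innerE e1 expr1n.
set r := 2 * inner x e *: e - x.
have nr : `|r| = `|x|.
  apply/eqP; rewrite -(@eqrXn2 _ 2)// -!innerE /r; apply/eqP.
  rewrite linearBl/= !linearBr/= !linearZl_LR/= !linearZr_LR/= ee.
  rewrite [inner e x]dot_sym rmorphM/= conjC_nat /GRing.scale/=; ring.
have -> : 2 * `|inner x e * inner e y| = `|inner r y + inner x y|.
  by rewrite linearBl/= linearZl_LR/= subrK -mulrA [RHS]normrM ger0_norm.
by rewrite (le_trans (ler_normD _ _))// lerD2r -nr cauchy_schwarz.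
Qed.

Lemma block_positive_cabs A B C x :
  positive_op A -> positive_op B ->
  positive_op (block_op A (adjoint C) C B) ->
  cabs (inner (C x) x) ^+ 2 <= cabs (inner (A x) x) * cabs (inner (B x) x).
Proof.
move=> pA pB pM; rewrite -lecR realcX realcM !cabsE.
rewrite (ger0_norm (pA x)) (ger0_norm (pB x)).
exact: block_positive_form.
Qed.

(** Buzano's inequality for [A x] and [B x]: by selfadjointness the inner
    product [inner (A x) (B x)] is the conjugate of [inner ((A * B) x) x]. *)
Lemma buzano_positive A B x : positive_op A -> positive_op B -> `|x| = 1 ->
  2 * (cabs (inner (A x) x) * cabs (inner (B x) x))
  <= cabs (A x) * cabs (B x) + cabs (inner ((A * B) x) x).
Proof.
move=> pA pB x1; rewrite -lecR realcD !realcM !cabsE rmorph_nat bop_mulE.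
rewrite -normrM [inner (B x) x]positive_op_selfadjoint//.
rewrite (le_trans (buzano _ _ x1))// lerD2l.
rewrite [inner (A (B x)) x]positive_op_selfadjoint//.
by rewrite -[leRHS]norm_conjC -dot_sym.
Qed.

(** * Suprema over the unit sphere *)

Lemma bop_unit_bounded T :
  exists M : R, forall x, `|x| = 1 -> cabs (T x) <= M.
Proof.
have [M M0 TM] := bop_gt0_bound T; exists (complex.Re M) => x x1.
by rewrite -lecR cabsE RRe_real ?gtr0_real// -[leRHS]mulr1 -x1.
Qed.

Lemma op_norm_ub T x : `|x| = 1 -> cabs (T x) <= op_norm T.
Proof.
move=> x1; apply: ub_le_sup; last by exists x.
by have [M TM] := bop_unit_bounded T; exists M => _ [y y1 <-]; exact: TM.
Qed.

Lemma euclidean_norm_ub d (T : 'I_d -> bop H) x : `|x| = 1 ->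
  Num.sqrt (\sum_(k < d) cabs (T k x) ^+ 2) <= euclidean_norm T.
Proof.
move=> x1; apply: ub_le_sup; last by exists x.
have [M TM] := choice (fun k => bop_unit_bounded (T k)).
exists (Num.sqrt (\sum_(k < d) M k ^+ 2)) => _ [y y1 <-].
by apply: sqrt_sum_sqr_le => k; rewrite cabs_ge0 TM.
Qed.

Lemma euclidean_radius_ub d (T : 'I_d -> bop H) x : `|x| = 1 ->
  Num.sqrt (\sum_(k < d) cabs (inner (T k x) x) ^+ 2) <= euclidean_radius T.
Proof.
move=> x1; apply: ub_le_sup; last by exists x.
have [M TM] := choice (fun k => bop_unit_bounded (T k)).
exists (Num.sqrt (\sum_(k < d) M k ^+ 2)) => _ [y y1 <-].
apply: sqrt_sum_sqr_le => k; rewrite cabs_ge0.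
exact: le_trans (cabs_inner_le _ y1) (TM k y y1).
Qed.

(** The right-hand side is a square root so that the claim also holds when the
    unit sphere is empty, the supremum being 0 in that case. *)
Lemma euclidean_radius_le_sqrt d (T : 'I_d -> bop H) (M : R) :
  (forall x, `|x| = 1 -> \sum_(k < d) cabs (inner (T k x) x) ^+ 2 <= M) ->
  euclidean_radius T <= Num.sqrt M.
Proof.
move=> TM; have [[x0 x01]|no] := pselect (exists x : H, `|x| = 1).
  apply: ge_sup; first by apply: image_nonempty; exists x0.
  by move=> _ [x x1 <-]; apply/ler_wsqrtr/TM.
rewrite /euclidean_radius sup_out ?sqrtr_ge0// => -[[_ [x x1 _]] _].
by apply: no; exists x.
Qed.

(** By selfadjointness, [|T x|^2 = inner ((T ^+ 2) x) x], so the left-hand side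
    is the quadratic form of the operator on the right, evaluated at [x]. *)
Lemma sum_sqr_norm_le_op_norm d (A B : 'I_d -> bop H) x :
  positive_tuple A -> positive_tuple B -> `|x| = 1 ->
  \sum_(k < d) (cabs (A k x) ^+ 2 + cabs (B k x) ^+ 2)
  <= op_norm (\sum_(k < d) (A k ^+ 2 + B k ^+ 2)).
Proof.
move=> pA pB x1; set S : bop H := \sum_(k < d) (A k ^+ 2 + B k ^+ 2).
rewrite (le_trans _ (op_norm_ub S x1))// (le_trans _ (cabs_inner_le S x1))//.
suff -> : \sum_k (cabs (A k x) ^+ 2 + cabs (B k x) ^+ 2) = cabs (inner (S x) x).
  by [].
have sqE T : positive_op T -> inner ((T ^+ 2) x) x = (cabs (T x) ^+ 2)%:C%C.
  move=> pT; rewrite realcX cabsE -innerE expr2 bop_mulE.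
  exact: positive_op_selfadjoint.
have -> : inner (S x) x
    = (\sum_k (cabs (A k x) ^+ 2 + cabs (B k x) ^+ 2))%:C%C.
  rewrite /S bop_sumE (linear_sumlz _ _) rmorph_sum; apply: eq_bigr => k _.
  by rewrite bop_addE linearDl/= !sqE// realcD.
rewrite ger0_norm// lecR.
by apply: sumr_ge0 => k _; rewrite addr_ge0 ?exprn_ge0 ?cabs_ge0.
Qed.

End Hilbert.

(** * The Euclidean operator radius of the off-diagonal tuple *)

(** The factor [Num.sqrt d%:R] comes from Cauchy-Schwarz against the constant
    family 1, which passes from the sum of the [|<A_k B_k x,x>|] to the square
    root of the sum of their squares. *)
Lemma sum_buzano_le (R : realType) (H : hilbertType R) d (A B : 'I_d -> bop H)
    (x : H) :
  positive_tuple A -> positive_tuple B -> `|x| = 1 ->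
  \sum_(k < d) cabs (inner (A k x) x) * cabs (inner (B k x) x)
  <= 1 / 2 * (\sum_(k < d) cabs (A k x) * cabs (B k x))
     + Num.sqrt d%:R / 2 * euclidean_radius (fun k => A k * B k).
Proof.
move=> pA pB x1; set w := euclidean_radius _.
have cw : \sum_(k < d) cabs (inner ((A k * B k) x) x) <= Num.sqrt d%:R * w.
  rewrite (le_trans _ (ler_wpM2l _ (euclidean_radius_ub _ x1))) ?sqrtr_ge0//.
  have := sum_mul_le_sqrt (fun=> 1) (fun k => cabs (inner ((A k * B k) x) x)).
  under eq_bigr do rewrite mul1r.
  under [X in Num.sqrt X * _]eq_bigr do rewrite expr1n.
  by rewrite sumr_const card_ord.
suff : 2 * (\sum_(k < d) cabs (inner (A k x) x) * cabs (inner (B k x) x))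
  <= \sum_(k < d) cabs (A k x) * cabs (B k x)
     + \sum_(k < d) cabs (inner ((A k * B k) x) x) by lra.
rewrite mulr_sumr -big_split/=; apply: ler_sum => k _.
exact: buzano_positive.
Qed.

Theorem theorem2p5 (R : realType) (H : hilbertType R) (d : nat)
    (A B C : 'I_d -> bop H) :
  (1 <= d)%N ->
  positive_tuple A -> positive_tuple B ->
  positive_tuple (fun k => block_op (A k) (adjoint (C k)) (C k) (B k)) ->
  [/\ euclidean_radius C
        <= Num.sqrt (1 / 2 * op_norm (\sum_(k < d) (A k ^+ 2 + B k ^+ 2))),
      euclidean_radius C
        <= Num.sqrt (1 / 2 * (euclidean_norm A * euclidean_norm B)
             + Num.sqrt d%:R / 2 * euclidean_radius (fun k => A k * B k))
    & euclidean_radius C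
        <= Num.sqrt (1 / 4 * op_norm (\sum_(k < d) (A k ^+ 2 + B k ^+ 2))
             + Num.sqrt d%:R / 2 * euclidean_radius (fun k => A k * B k))].
Proof.
move=> _ pA pB pM.
have CAB x : \sum_(k < d) cabs (inner (C k x) x) ^+ 2
    <= \sum_(k < d) cabs (inner (A k x) x) * cabs (inner (B k x) x).
  by apply: ler_sum => k _; exact: block_positive_cabs.
have amgm (a b : 'I_d -> R) :
    \sum_k a k * b k <= 1 / 2 * \sum_k (a k ^+ 2 + b k ^+ 2).
  rewrite mulr_sumr; apply: ler_sum => k _.
  by have := sqr_ge0 (a k - b k); lra.
split; apply: euclidean_radius_le_sqrt => x x1; apply: le_trans (CAB x) _.
- apply: le_trans (amgm _ _) _; rewrite ler_wpM2l ?divr_ge0//.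
  apply: le_trans _ (sum_sqr_norm_le_op_norm pA pB x1).
  by apply: ler_sum => k _; apply: lerD;
    rewrite ler_pXn2r ?nnegrE ?cabs_ge0 ?cabs_inner_le.
- apply: le_trans (sum_buzano_le pA pB x1) _.
  rewrite lerD2r ler_wpM2l ?divr_ge0//.
  apply: le_trans (sum_mul_le_sqrt _ _) _.
  by apply: ler_pM; rewrite ?sqrtr_ge0 ?euclidean_norm_ub.
- apply: le_trans (sum_buzano_le pA pB x1) _.
  rewrite lerD2r (_ : 1 / 4 = 1 / 2 * (1 / 2) :> R); last by lra.
  rewrite -[leRHS]mulrA ler_wpM2l ?divr_ge0//.
  apply: le_trans (amgm _ _) _; rewrite ler_wpM2l ?divr_ge0//.
  exact: sum_sqr_norm_le_op_norm.
Qed.
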